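(* Let $\mathbb{F}$ be a field, let $u$ be a finite-rank endomorphism of an $\mathbb{F}$-vector space $V$, and assume that $u$ is the sum of three square-zero endomorphisms of $V$. Then $\operatorname{tr}(u)=0$.
   Context: $\mathbb{F}$ is an arbitrary field and $V$ may have any dimension. An endomorphism $v$ of $V$ is square-zero if $v^2=0$. The endomorphism $u$ has finite rank if $\operatorname{Im} u$ is finite-dimensional; its trace $\operatorname{tr}(u)$ is then the trace of the endomorphism of the finite-dimensional space $\operatorname{Im} u$ induced by $u$. *)

(* Defs.v *)
From mathcomp Require Import all_boot all_algebra.
From mathcomp Require Import boolp classical_sets.

Set Implicit Arguments.
Unset Strict Implicit.
Unset Printing Implicit Defensive.

Import GRing.Theory.
Local Open Scope classical_set_scope.
Local Open Scope ring_scope.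

Section FiniteRank.
Variables (F : fieldType) (V : lmodType F).
Implicit Types (u : {linear V -> V}) (W : set V).

Definition square_zero u : Prop := forall x, u (u x) = 0.

Definition lincomb n (b : 'I_n -> V) (c : 'I_n -> F) : V :=
  \sum_i c i *: b i.

Definition lin_indep n (b : 'I_n -> V) : Prop :=
  forall c : 'I_n -> F, lincomb b c = 0 -> forall i, c i = 0.

Definition is_basis n (b : 'I_n -> V) W : Prop :=
  lin_indep b /\ W = range (lincomb b).

Definition finite_dim W : Prop := exists n (b : 'I_n -> V), is_basis b W.

Definition finite_rank u : Prop := finite_dim (range u).

(* Row convention: row [i] of [A] holds the coordinates of [u (b i)]. *)
Definition represents n (b : 'I_n -> V) (A : 'M[F]_n) u : Prop :=
  forall i, u (b i) = lincomb b (A i).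

(* Trace of the endomorphism of [Im u] induced by [u], computed in any basis of
   [Im u]; see [trE] for independence of the basis and [finite_rank_matrix] for
   existence.  The default value 1 is only taken when [u] does not have finite
   rank. *)
Definition tr u : F :=
  xget 1 [set t | exists n (b : 'I_n -> V) (A : 'M[F]_n),
                    [/\ is_basis b (range u), represents b A u & t = \tr A]].

Lemma lincomb_inj n (b : 'I_n -> V) (c d : 'I_n -> F) :
  lin_indep b -> lincomb b c = lincomb b d -> c =1 d.
Proof.
move=> fb cd i; apply/eqP; rewrite -subr_eq0; apply/eqP.
apply: (fb (fun i => c i - d i)).
rewrite /lincomb; under eq_bigr do rewrite scalerBl.
by rewrite sumrB; apply/eqP; rewrite subr_eq0; apply/eqP.
Qed.

Lemma lincomb_comp n m (b : 'I_n -> V) (b' : 'I_m -> V) (P : 'M[F]_(n, m))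
    (c : 'I_n -> F) :
  (forall i, b i = lincomb b' (P i)) ->
  lincomb b c = lincomb b' (fun j => \sum_i c i * P i j).
Proof.
move=> bP; rewrite /lincomb.
under eq_bigr => i _ do rewrite bP scaler_sumr.
rewrite exchange_big /=; apply: eq_bigr => j _; rewrite scaler_suml.
by apply: eq_bigr => i _; rewrite scalerA.
Qed.

Lemma coord_mx n m (b : 'I_n -> V) (f : 'I_m -> V) :
  (forall i, range (lincomb b) (f i)) ->
  exists A : 'M[F]_(m, n), forall i, f i = lincomb b (A i).
Proof.
move=> bf.
have {}bf i : exists c : 'I_n -> F, f i = lincomb b c.
  by have [c _ <-] := bf i; exists c.
have [c fc] := choice bf.
exists (\matrix_(i, j) c i j) => i.
by rewrite fc; apply: eq_bigr => j _; rewrite mxE.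
Qed.

Lemma basis_mem n (b : 'I_n -> V) W i : is_basis b W -> W (b i).
Proof.
move=> [_ ->]; exists (fun j => (j == i)%:R) => //.
rewrite /lincomb (bigD1 i) //= eqxx scale1r big1 ?addr0 // => j /negPf ->.
by rewrite scale0r.
Qed.

Lemma finite_rank_matrix u n (b : 'I_n -> V) :
  is_basis b (range u) -> exists A : 'M[F]_n, represents b A u.
Proof. by move=> [_ bu]; apply: coord_mx => i; rewrite -bu; exists (b i). Qed.

Lemma trace_basis_indep u n m (b : 'I_n -> V) (b' : 'I_m -> V)
    (A : 'M[F]_n) (A' : 'M[F]_m) :
  is_basis b (range u) -> represents b A u ->
  is_basis b' (range u) -> represents b' A' u -> \tr A = \tr A'.
Proof.
move=> bb bA bb' bA'.
have [P bP] : exists P : 'M[F]_(n, m), forall i, b i = lincomb b' (P i).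
  by apply: coord_mx => i; rewrite -bb'.2; apply: basis_mem bb.
have [Q bQ] : exists Q : 'M[F]_(m, n), forall i, b' i = lincomb b (Q i).
  by apply: coord_mx => i; rewrite -bb.2; apply: basis_mem bb'.
have ulin k (d : 'I_k -> V) c : u (lincomb d c) = lincomb (u \o d) c.
  by rewrite /lincomb linear_sum; apply: eq_bigr => i _; rewrite linearZ_LR.
have AQ : A' *m Q = Q *m A.
  apply/matrixP => i j; rewrite !mxE.
  apply: (@lincomb_inj _ b (fun j => \sum_k A' i k * Q k j)
            (fun j => \sum_k Q i k * A k j) bb.1).
  rewrite -(lincomb_comp _ bQ) -bA' bQ ulin.
  exact: (lincomb_comp _ bA).
have PQ : P *m Q = 1%:M.
  apply/matrixP => i j; rewrite !mxE.
  apply: (@lincomb_inj _ b (fun j => \sum_k P i k * Q k j)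
            (fun j => (i == j)%:R) bb.1).
  rewrite -(lincomb_comp _ bQ) -bP /lincomb (bigD1 i) //= eqxx scale1r.
  by rewrite big1 ?addr0 // => k; rewrite eq_sym => /negPf ->; rewrite scale0r.
have QP : Q *m P = 1%:M.
  apply/matrixP => i j; rewrite !mxE.
  apply: (@lincomb_inj _ b' (fun j => \sum_k Q i k * P k j)
            (fun j => (i == j)%:R) bb'.1).
  rewrite -(lincomb_comp _ bP) -bQ /lincomb (bigD1 i) //= eqxx scale1r.
  by rewrite big1 ?addr0 // => k; rewrite eq_sym => /negPf ->; rewrite scale0r.
by rewrite -[A]mul1mx -PQ -mulmxA -AQ mxtrace_mulC -mulmxA QP mulmx1.
Qed.

Lemma trE u n (b : 'I_n -> V) (A : 'M[F]_n) :
  is_basis b (range u) -> represents b A u -> tr u = \tr A.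
Proof.
move=> bb bA; apply: xget_unique; first by exists n, b, A.
by move=> _ [m [b' [A' [bb' bA' ->]]]]; exact: trace_basis_indep bb' bA' bb bA.
Qed.

End FiniteRank.

(* Main.v *)
(** The square-zero summands [a], [b], [c] of [u] may have infinite rank, so
    their traces make no sense on [V].  Modulo finite-rank operators, however,
    [a + b = - c] squares to zero, so [a] and [b] anticommute.  Hence the
    finite-dimensional space [U = Im u + b (Im u) + a (Im u + b (Im u))] is
    stable under [a] and [b]; it contains [Im u], so it is stable under [c] as
    well.  On [U] the three summands are nilpotent, hence of trace zero. *)
Require Import Defs.
From mathcomp Require Import all_boot all_algebra.
From mathcomp Require Import boolp classical_sets.

Set Implicit Arguments.
Unset Strict Implicit.
Unset Printing Implicit Defensive.

Import GRing.Theory.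
Local Open Scope classical_set_scope.
Local Open Scope ring_scope.

(** Take the full-rank factorization [A = C *m R], with [C] the column base and [R] the row base.
    Then [A *m A = C *m (R *m C) *m R] vanishes; cancelling [C] and [R] gives [R *m C = 0], whose
    trace is that of [A]. *)
Lemma mxtrace_square_zero (F : fieldType) n (A : 'M[F]_n) :
  A *m A = 0 -> \tr A = 0.
Proof.
move=> A0; rewrite -(mulmx_base A) mxtrace_mulC.
suff -> : row_base A *m col_base A = 0 by rewrite mxtrace0.
apply: (row_free_inj (row_base_free A)); apply: (row_full_inj (col_base_full A)).
by rewrite mul0mx mulmx0 -mulmxA mulmxA !mulmx_base.
Qed.

Section FiniteDimension.
Variables (F : fieldType) (V : lmodType F).
Implicit Types (u v : {linear V -> V}) (W : set V).

Lemma linear_lincomb u n (b : 'I_n -> V) c :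
  u (lincomb b c) = lincomb (u \o b) c.
Proof.
by rewrite /lincomb linear_sum; apply: eq_bigr => i _; rewrite linearZ_LR.
Qed.

Lemma finite_dim_span n (g : 'I_n -> V) : finite_dim (range (lincomb g)).
Proof.
elim: n g => [|n IHn] g; first by exists 0, g; split=> // c _ [].
have [gfree|] := pselect (lin_indep g); first by exists n.+1, g.
move=> /existsNP[c /not_implyP[c0 /existsNP[i /eqP ci]]].
suff -> : range (lincomb g) = range (lincomb (g \o lift i)) by exact: IHn.
have gi : g i = lincomb (g \o lift i) (fun j => - (c i)^-1 * c (lift i j)).
  move: c0; rewrite /lincomb (bigD1_ord i) //= => /eqP.
  rewrite addr_eq0 => /eqP cg.
  rewrite -[LHS](scalerK ci) cg scalerN -scaleNr scaler_sumr.
  by apply: eq_bigr => j _; rewrite scalerA.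
apply/seteqP; split=> _ [d _ <-].
  exists (fun j => d i * (- (c i)^-1 * c (lift i j)) + d (lift i j)) => //.
  rewrite {2}/lincomb (bigD1_ord i) //= gi /lincomb scaler_sumr -big_split.
  by apply: eq_bigr => j _ /=; rewrite scalerDl scalerA.
exists (fun k => if unlift i k is Some j then d j else 0) => //.
rewrite /lincomb (bigD1_ord i) //= unlift_none scale0r add0r.
by apply: eq_bigr => j _; rewrite liftK.
Qed.

Lemma finite_dim_image u W : finite_dim W -> finite_dim (u @` W).
Proof.
move=> [n [b [_ ->]]].
suff -> : u @` range (lincomb b) = range (lincomb (u \o b)).
  exact: finite_dim_span.
by rewrite image_comp; apply: eq_imagel => c _ /=; rewrite linear_lincomb.
Qed.

Lemma finite_dim_add W W' : finite_dim W -> finite_dim W' ->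
  finite_dim [set x + y | x in W & y in W'].
Proof.
move=> [n [b [_ ->]]] [m [b' [_ ->]]].
(* The concatenated family may be dependent, since [W] and [W'] may intersect; spanning is enough
   for [finite_dim_span]. *)
pose g (k : 'I_(n + m)) :=
  match fintype.split k with inl i => b i | inr j => b' j end.
have gE c : lincomb g c = lincomb b (c \o lshift m) + lincomb b' (c \o @rshift n m).
  rewrite /lincomb big_split_ord /=; congr (_ + _); apply: eq_bigr => i _.
    by rewrite /g (unsplitK (inl i)).
  by rewrite /g (unsplitK (inr i)).
suff -> : [set x + y | x in range (lincomb b) & y in range (lincomb b')]
          = range (lincomb g) by exact: finite_dim_span.
apply/seteqP; split=> [_ [_ [c _ <-] [_ [d _ <-] <-]]|_ [c _ <-]]; last first.
  rewrite gE; exists (lincomb b (c \o lshift m)); first by exists (c \o lshift m).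
  by exists (lincomb b' (c \o @rshift n m)); first by exists (c \o @rshift n m).
exists (fun k => match fintype.split k with inl i => c i | inr j => d j end) => //.
rewrite gE /lincomb; congr (_ + _); apply: eq_bigr => i _ /=.
  by rewrite (unsplitK (inl i)).
by rewrite (unsplitK (inr i)).
Qed.

Lemma stable_represents v n (b : 'I_n -> V) W :
  is_basis b W -> (forall x, W x -> W (v x)) -> exists A, represents b A v.
Proof.
move=> bW vW; apply: coord_mx => i; rewrite -bW.2.
apply: vW; exact: Defs.basis_mem bW.
Qed.

Lemma trace_square_zero_represents v n (b : 'I_n -> V) (A : 'M[F]_n) :
  lin_indep b -> represents b A v -> square_zero v -> \tr A = 0.
Proof.
move=> bfree bA v0; apply: mxtrace_square_zero; apply/matrixP => i j.
rewrite !mxE; apply: (bfree (fun j => \sum_k A i k * A k j)).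
by rewrite -(lincomb_comp _ bA) -[LHS]linear_lincomb -bA v0.
Qed.

(** Let [P] be the matrix of the inclusion of [range u] in [W], and [Q] that of [u] from [W] to
    [range u]. In the row convention [u] has matrix [P *m Q] on [range u] and [Q *m P] on [W], and
    these have the same trace. *)
Lemma tr_stable_space u n (e : 'I_n -> V) (M : 'M[F]_n) W :
  finite_rank u -> is_basis e W -> range u `<=` W -> represents e M u ->
  tr u = \tr M.
Proof.
move=> [r [b bu]] eW uW eM; have [A bA] := finite_rank_matrix bu.
have [P bP] : exists P : 'M[F]_(r, n), forall i, b i = lincomb e (P i).
  by apply: coord_mx => i; rewrite -eW.2; apply/uW; apply: Defs.basis_mem bu.
have [Q eQ] : exists Q : 'M[F]_(n, r), forall i, (u \o e) i = lincomb b (Q i).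
  by apply: coord_mx => i; rewrite -bu.2; exists (e i).
have AE : A = P *m Q.
  apply/matrixP => i j; rewrite !mxE.
  apply: (lincomb_inj (d := fun j => \sum_k P i k * Q k j) bu.1).
  by rewrite -bA bP linear_lincomb (lincomb_comp _ eQ).
have ME : M = Q *m P.
  apply/matrixP => i j; rewrite !mxE.
  apply: (lincomb_inj (d := fun j => \sum_k Q i k * P k j) eW.1).
  by rewrite -eM -(lincomb_comp _ bP) -eQ.
by rewrite (trE bu bA) AE ME mxtrace_mulC.
Qed.

End FiniteDimension.

Theorem proposition4 (F : fieldType) (V : lmodType F) (u : {linear V -> V}) :
  finite_rank u ->
  (exists a b c : {linear V -> V},
     [/\ square_zero a, square_zero b, square_zero c
       & forall x : V, u x = (a x + b x + c x)%R]) ->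
  tr u = 0%R.
Proof.
move=> fu [a [b [c [a0 b0 c0 uE]]]].
pose X := [set x + y | x in range u & y in b @` range u].
pose U := [set x + y | x in X & y in a @` X].
have fX : finite_dim X := finite_dim_add fu (finite_dim_image b fu).
have [n [e eU]] : finite_dim U := finite_dim_add fX (finite_dim_image a fX).
have XI p q : X (u p + b (u q)).
  by exists (u p); [exists p | exists (b (u q)); [exists (u q); [exists q|]|]].
have UI p q r s : U (u p + b (u q) + a (u r + b (u s))).
  exists (u p + b (u q)) => //; exists (a (u r + b (u s))) => //.
  by exists (u r + b (u s)).
have UE x : U x -> exists p q r s, x = u p + b (u q) + a (u r + b (u s)).
  move=> [_ [_ [p _ <-] [_ [_ [q _ <-] <-] <-]]].
  move=> [_ [_ [_ [r _ <-] [_ [_ [s _ <-] <-] <-]] <-] <-].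
  by exists p, q, r, s.
(* Exact form of the anticommutation modulo finite rank: [b a + a b = b u - u c + a u]. It combines
   [b u = b a + b c], from [b b = 0], with [b c = u c - a c], from [c c = 0], and [a c = a (u - b)],
   from [a a = 0]. *)
have baE x : b (a x) = b (u x) - u (c x) + a (u x - b x).
  have cE y : c y = u y - a y - b y by rewrite uE -addrA -opprD addrC addKr.
  have acE : a (c x) = a (u x - b x) by rewrite cE addrAC linearB /= a0 subr0.
  have bcE : b (c x) = u (c x) - a (c x).
    by apply/esym/subr0_eq; rewrite -cE.
  rewrite -acE -addrA [- _ + _]addrC -opprB -bcE -linearB /= uE addrK.
  by rewrite linearD /= b0 addr0.
have aU x : U x -> U (a x).
  move=> /UE[p [q [r [s ->]]]]; rewrite linearD /= a0 addr0.
  by have := UI 0 0 p q; rewrite !linear0 !add0r.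
have bX p q : b (u p + b (u q)) = b (u p) by rewrite linearD /= b0 addr0.
have bU x : U x -> U (b x).
  move=> /UE[p [q [r [s ->]]]]; set y := u r + b (u s).
  (* The witnesses come from [baE] at [y]: the term [- u (c y)] lies in [range u], [b (u y)] joins
     [b (u p)], and [b y = b (u r)] puts [u y - b y] in [X]. *)
  have := UI (- c y) (p + y) y (- r).
  congr U; rewrite [RHS]linearD /= baE !bX [RHS]addrA.
  rewrite !(linearN u) (linearN b) [u (p + y)]linearD [b (u p + u y)]linearD /=.
  by rewrite [- u (c y) + _]addrC addrA.
have uU : range u `<=` U.
  by move=> _ [p _ <-]; have := UI p 0 0 0; rewrite !linear0 !addr0 linear0 addr0.
have [A eA] := stable_represents eU aU.
have [B eB] := stable_represents eU bU.
have [M eM] : exists M, represents e M u.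
  by apply: (stable_represents eU) => x _; apply: uU; exists x.
(* Since [c = u - a - b], its matrix is determined by the other three; its zero trace then gives
   [\tr M = \tr A + \tr B]. *)
have eC : represents e (M - A - B) c.
  move=> i; have /eqP := uE (e i).
  rewrite addrC -subr_eq opprD addrA eM eA eB => /eqP <-.
  by rewrite /lincomb -!sumrB; apply: eq_bigr => j _; rewrite !mxE !scalerBl.
have := trace_square_zero_represents eU.1 eC c0.
rewrite (tr_stable_space fu eU uU eM) !linearB /=.
rewrite (trace_square_zero_represents eU.1 eA a0).
by rewrite (trace_square_zero_represents eU.1 eB b0) !subr0.
Qed.
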